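(* Let $X$ be a uniformly convex real Banach space, $\dim X\ge2$, whose modulus of convexity has a power type, and let $\Omega\subsetneq X$ be open and path-connected. Then each quasihyperbolic geodesic $\gamma\subset\Omega$ is $C^1$-smooth; that is, if $\gamma\colon[a,b]\to\Omega$ is a quasihyperbolic geodesic parametrized by norm arc length, then $\gamma'(t)$ exists (as a norm limit of difference quotients) for every $t\in(a,b)$ and $\gamma'$ is continuous on $(a,b)$.
   Context: The modulus of convexity of $X$ is $\delta_X(\epsilon)=\inf\{1-\|x+y\|/2:\ x,y\in X,\ \|x\|=\|y\|=1,\ \|x-y\|=\epsilon\}$ for $0<\epsilon\le2$. $X$ is uniformly convex if $\delta_X(\epsilon)>0$ for all $\epsilon\in(0,2]$, and its modulus of convexity has a power type if there are $p\in[2,\infty)$ and $c>0$ with $\delta_X(\epsilon)\ge c\,\epsilon^p$ for all $\epsilon\in(0,2]$. The quasihyperbolic length of a rectifiable arc $\gamma$ in $\Omega$ is $\ell_{\mathrm{qh}}(\gamma)=\int_\gamma \frac{ds}{\mathrm{dist}(\cdot,\partial\Omega)}$, where the integral is with respect to norm arc length and $\mathrm{dist}$ is the norm distance. The quasihyperbolic metric is $k_\Omega(x,y)=\inf_\gamma \ell_{\mathrm{qh}}(\gamma)$, the infimum over rectifiable arcs in $\Omega$ joining $x$ and $y$. A quasihyperbolic geodesic joining $x$ and $y$ is a rectifiable arc in $\Omega$ joining them for which this infimum is attained. $C^1$-smoothness of a path on $[a,b]$ means that the derivative exists and is continuous away from the endpoints $a$ and $b$. *)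

(* Defs.v *)
From HB Require Import structures.
From mathcomp Require Import all_boot all_order all_algebra.
From mathcomp Require Import all_classical all_reals all_analysis.

Set Implicit Arguments.
Unset Strict Implicit.
Unset Printing Implicit Defensive.

Import Order.TTheory GRing.Theory Num.Theory.
Import numFieldNormedType.Exports.

Local Open Scope classical_set_scope.
Local Open Scope ring_scope.

Definition dim_ge2 (R : realType) (X : normedModType R) : Prop :=
  exists x y : X, forall a b : R, a *: x + b *: y = 0 -> a = 0 /\ b = 0.

(* When dim X >= 2 and 0 < eps <= 2 the set below is nonempty, so that the
   junk value [inf set0 = 0] does not occur. *)
Definition modulus_convexity (R : realType) (X : normedModType R) (eps : R)
    : R :=
  inf [set r : R | exists x y : X,
    [/\ `|x| = 1, `|y| = 1, `|x - y| = eps & r = 1 - `|x + y| / 2]].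

Definition uniformly_convex (R : realType) (X : normedModType R) : Prop :=
  forall eps : R, 0 < eps -> eps <= 2 -> 0 < modulus_convexity X eps.

Definition power_type_convexity (R : realType) (X : normedModType R) : Prop :=
  exists p c : R, [/\ 2 <= p, 0 < c &
    forall eps : R, 0 < eps -> eps <= 2 ->
      c * eps `^ p <= modulus_convexity X eps].

Definition boundary (T : topologicalType) (A : set T) : set T :=
  closure A `\` interior A.

Definition path_connected (R : realType) (X : normedModType R) (A : set X)
    : Prop :=
  forall x y, A x -> A y -> exists f : R -> X,
    [/\ {within `[0, 1], continuous f}, f 0 = x, f 1 = y &
        f @` `[0, 1] `<=` A].

Definition norm_dist (R : realType) (X : normedModType R) (A : set X) (x : X)
    : R :=
  inf [set `|x - y| | y in A].

(* The library's [variation] is restricted to real-valued functions. *)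
Definition curve_variation (R : realType) (X : normedModType R) (g : R -> X)
    (a b : R) (s : seq R) : R :=
  let F := g \o nth b (a :: s) in
  \sum_(0 <= n < size s) `|F n.+1 - F n|.

Definition curve_length (R : realType) (X : normedModType R) (g : R -> X)
    (a b : R) : \bar R :=
  ereal_sup [set (curve_variation g a b s)%:E | s in itv_partition a b].

(* Arcs are injective paths; [a = b] is allowed, so that a point is joined to
   itself by a constant arc.  Values of [g] outside [a, b] are irrelevant. *)
Definition rectifiable_arc (R : realType) (X : normedModType R)
    (Omega : set X) (g : R -> X) (a b : R) : Prop :=
  [/\ a <= b, {within `[a, b], continuous g}, {in `[a, b] &, injective g},
      g @` `[a, b] `<=` Omega & (curve_length g a b < +oo)%E].

(* The point of the arc at arc length s from [g a]. *)
Definition arc_length_reparam (R : realType) (X : normedModType R)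
    (g : R -> X) (a b s : R) : X :=
  g (inf [set t : R | t \in `[a, b] /\ (s%:E <= curve_length g a t)%E]).

Definition arc_integral (R : realType) (X : normedModType R)
    (f : X -> R) (g : R -> X) (a b : R) : \bar R :=
  (\int[lebesgue_measure]_(s in `[0%R, fine (curve_length g a b)])
     (f (arc_length_reparam g a b s))%:E)%E.

Definition qh_length (R : realType) (X : normedModType R) (Omega : set X)
    (g : R -> X) (a b : R) : \bar R :=
  arc_integral (fun x => (norm_dist (boundary Omega) x)^-1) g a b.

Definition qh_metric (R : realType) (X : normedModType R) (Omega : set X)
    (x y : X) : \bar R :=
  ereal_inf [set l : \bar R | exists (g : R -> X) (a b : R),
    [/\ rectifiable_arc Omega g a b, g a = x, g b = y &
        l = qh_length Omega g a b]].

Definition qh_geodesic (R : realType) (X : normedModType R) (Omega : set X)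
    (g : R -> X) (a b : R) : Prop :=
  rectifiable_arc Omega g a b /\
  qh_length Omega g a b = qh_metric Omega (g a) (g b).

Definition param_by_arc_length (R : realType) (X : normedModType R)
    (g : R -> X) (a b : R) : Prop :=
  forall s t : R, a <= s -> s <= t -> t <= b ->
    curve_length g s t = (t - s)%:E.

(* [derivable g t 1] is norm convergence of the difference quotients, and
   [derive1 g] is their limit. *)
Definition C1_smooth (R : realType) (X : normedModType R) (g : R -> X)
    (a b : R) : Prop :=
  forall t : R, a < t -> t < b ->
    derivable g t 1 /\ {for t, continuous (derive1 g)}.

(* Main.v *)
Require Import Defs.
From mathcomp Require Import all_boot all_order all_algebra.
From mathcomp Require Import all_classical all_reals all_analysis.
From mathcomp Require Import lra ring.

(** The distance d to the boundary is 1-Lipschitz.  On a short piece of a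
    quasihyperbolic geodesic gamma from p = gamma s to gamma t, of norm length
    h = t - s, the density 1/d is therefore at least 1/(d p + h), whereas on
    the chord it is at most 1/(d p - h).  Replacing the piece by its chord
    cannot shorten gamma, so h/(d p + h) <= |gamma t - gamma s|/(d p - h), whence
      |gamma t - gamma s| >= h - (2/d p) h^2   ([qh_minimizing_chord_ge]).
    The modified curve may run into itself, and then it is not an arc.  This is
    cured by keeping only the part of the chord after its last visit to gamma
    before s and before its next visit to gamma after t ([chord_erasure]); the
    estimate survives because the density is nonnegative.

    Let x and y be the slopes of gamma on two adjacent intervals of comparable
    length, whose union has length h.  Both lie in the unit ball, and the chord
    estimate makes |x + y| >= 2 - O(h).  A modulus of convexity of power type q
    then gives |x - y| = O(h^(1/q)) ([balanced_slopes]).  Halving the interval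
    repeatedly and summing a geometric series, all slopes at s with step at
    most h differ by O(h^(1/q)) ([slope_compare]).  By completeness they
    converge to a derivative, which inherits this Hoelder bound and is thus
    continuous.

    Competing curves are assembled from pieces that are already parametrized by
    arc length ([unit_arc]), so that the arc length reparametrization in the
    definition of the quasihyperbolic length becomes a translation. *)

Import Order.TTheory GRing.Theory Num.Theory.
Import numFieldNormedType.Exports.

Set Implicit Arguments.
Unset Strict Implicit.
Unset Printing Implicit Defensive.

Local Open Scope classical_set_scope.
Local Open Scope ring_scope.

(** * Curve length and parametrization by arc length *)

Section CurveLength.
Context {R : realType} {X : normedModType R}.
Implicit Types (f g : R -> X) (a b c s t u v k : R) (p q : seq R).

Lemma curve_variation_nil g a b : curve_variation g a b [::] = 0.
Proof. by rewrite /curve_variation big_geq. Qed.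

Lemma curve_variation_cons g a b x p :
  curve_variation g a b (x :: p) = `|g x - g a| + curve_variation g x b p.
Proof. by rewrite /curve_variation /= big_nat_recl. Qed.

Lemma curve_variation_cat g a b c p q : itv_partition a b p ->
  curve_variation g a c (p ++ q) =
  curve_variation g a b p + curve_variation g b c q.
Proof.
elim: p a => [|x p IH] a.
  by move=> /itv_partition_nil ->; rewrite curve_variation_nil add0r.
by move=> /itv_partition_cons/IH {}IH; rewrite /= !curve_variation_cons IH addrA.
Qed.

Lemma itv_partition_head (a b x : R) p :
  itv_partition a b (x :: p) -> a < x <= b.
Proof.
move=> h; have /itv_partition_le -> := itv_partition_cons h.
by case: h => /= /andP[-> _] _.
Qed.

Lemma curve_length_ge_dist g s t : s <= t ->
  (`|g t - g s|%:E <= curve_length g s t)%E.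
Proof.
rewrite le_eqVlt => /predU1P[->|st]; apply: ereal_sup_ubound => /=.
  exists [::]; first by split => /=.
  by rewrite curve_variation_nil subrr normr0.
exists [:: t]; first exact: itv_partition1.
by rewrite curve_variation_cons curve_variation_nil addr0.
Qed.

Lemma curve_length_le g s t :
  {in `[s, t] &, forall u v, `|g u - g v| <= `|u - v|} ->
  (curve_length g s t <= (t - s)%:E)%E.
Proof.
move=> gl; apply: ge_ereal_sup => _ /= [p + <-]; rewrite lee_fin.
elim: p s gl => [|x p IH] s gl sp.
  by rewrite curve_variation_nil subr_ge0 (itv_partition_le sp).
have /andP[sx xt] := itv_partition_head sp.
rewrite curve_variation_cons.
have h1 : `|g x - g s| <= x - s.
  rewrite -[leRHS]ger0_norm ?subr_ge0 ?(ltW sx)// gl// in_itv/= ?lexx ?xt ?(ltW sx)//.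
  exact: le_trans (ltW sx) xt.
have h2 : curve_variation g x t p <= t - x.
  apply: IH; last exact: itv_partition_cons sp.
  move=> u v /[!in_itv]/= /andP[u1 u2] /andP[v1 v2]; apply: gl;
    by rewrite in_itv/= ?u2 ?v2 ?(le_trans (ltW sx))//.
lra.
Qed.

(** Superadditivity of the length, the nontrivial half of its additivity for
    curves parametrized by arc length. *)
Lemma curve_lengthD_ge g a b c (x y : R) :
  curve_length g a c = x%:E -> curve_length g c b = y%:E ->
  ((x + y)%:E <= curve_length g a b)%E.
Proof.
move=> gx gy; rewrite EFinD -leeBrDr// -gx; apply: ge_ereal_sup => _ [p pp <-].
rewrite leeBrDr// addeC -leeBrDr// -gy; apply: ge_ereal_sup => _ [q qq <-].
rewrite leeBrDr// -EFinD addrC -(curve_variation_cat _ _ _ pp).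
by apply: ereal_sup_ubound; exists (p ++ q) => //; apply: itv_partition_cat pp qq.
Qed.

Lemma eq_curve_length f g s t : {in `[s, t], f =1 g} ->
  curve_length f s t = curve_length g s t.
Proof.
move=> fg; congr ereal_sup; apply: eq_imagel => p sp; congr EFin.
elim: p s fg sp => [|x p IH] s fg sp; first by rewrite !curve_variation_nil.
have /andP[sx xt] := itv_partition_head sp.
rewrite !curve_variation_cons IH.
- by rewrite !fg// in_itv/= ?lexx ?xt ?(ltW sx)// (le_trans (ltW sx)).
- move=> u /[!in_itv]/= /andP[xu ut]; apply: fg.
  by rewrite in_itv/= ut (le_trans (ltW sx)).
- exact: itv_partition_cons sp.
Qed.

Lemma curve_length_shift_ge g s t k :
  (curve_length g (s + k) (t + k) <= curve_length (g \o +%R^~ k) s t)%E.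
Proof.
apply: ge_ereal_sup => _ /= [p pp <-]; apply: ereal_sup_ubound => /=.
exists [seq x - k | x <- p].
  elim: p s pp => [|x p IH] s pp.
    by have /addIr -> := itv_partition_nil pp; split => /=.
  have /andP[sx xt] := itv_partition_head pp.
  have [] := IH (x - k); first by rewrite subrK; exact: itv_partition_cons pp.
  by split => //=; rewrite ltrBrDr sx.
congr EFin; elim: p s pp => [|x p IH] s pp; first by rewrite !curve_variation_nil.
rewrite /= !curve_variation_cons/= IH subrK//.
exact: itv_partition_cons pp.
Qed.

(** A curve that is 1-Lipschitz on the whole line. *)
Definition nonexpansive g := forall u v, `|g u - g v| <= `|u - v|.

Lemma nonexpansive_continuous g : nonexpansive g -> continuous g.
Proof.
move=> gn x; apply/cvgrPdist_lt => e e0; near=> y.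
apply: le_lt_trans (gn _ _) _; near: y; exact: cvgr_dist_lt.
Unshelve. all: by end_near. Qed.

(** The concatenation at the parameter c of two curves.  At c itself the value
    is that of the first curve; the lemmas assume that the curves agree there. *)
Definition paste c f g : R -> X := fun u => if u <= c then f u else g u.

Lemma paste_left c f g u : u <= c -> paste c f g u = f u.
Proof. by rewrite /paste => ->. Qed.

Lemma paste_right c f g u : f c = g c -> c <= u -> paste c f g u = g u.
Proof.
rewrite /paste => fg cu; case: ifPn => // uc.
by have <- : c = u by apply/eqP; rewrite eq_le cu uc.
Qed.

Lemma nonexpansive_paste c f g : f c = g c ->
  nonexpansive f -> nonexpansive g -> nonexpansive (paste c f g).
Proof.
move=> fg fn gn.
suff H u v : u <= v -> `|paste c f g u - paste c f g v| <= `|u - v|.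
  by move=> u v; have [/H//|/ltW/H] := leP u v; rewrite distrC (distrC u).
move=> uv; have [vc|cv] := leP v c.
  by rewrite !paste_left// (le_trans uv).
have [uc|cu] := leP u c; last by rewrite !paste_right// ltW.
rewrite paste_left// paste_right// ?(ltW cv)//.
rewrite -(subrKA (f c)) {2}fg (le_trans (ler_normD _ _))//.
apply: le_trans (lerD (fn _ _) (gn _ _)) _.
by rewrite !ler0_norm ?subr_le0// ?(ltW cv)// -opprD subrKA.
Qed.

(** For a 1-Lipschitz curve the upper bound on the length is automatic. *)
Lemma param_by_arc_length_nonexpansive g a b :
  nonexpansive g ->
  (forall s t, a <= s -> s <= t -> t <= b ->
     ((t - s)%:E <= curve_length g s t)%E) ->
  param_by_arc_length g a b.
Proof.
move=> gn h s t *; apply/eqP; rewrite eq_le h// andbT.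
by apply: curve_length_le => // u v _ _; apply: gn.
Qed.

Lemma param_by_arc_length_paste c f g a b : f c = g c ->
  nonexpansive f -> nonexpansive g ->
  param_by_arc_length f a c -> param_by_arc_length g c b ->
  param_by_arc_length (paste c f g) a b.
Proof.
move=> fg fn gn pf pg; apply: param_by_arc_length_nonexpansive.
  exact: nonexpansive_paste.
have L s t : a <= s -> s <= t -> t <= c ->
    curve_length (paste c f g) s t = (t - s)%:E.
  move=> *; rewrite (@eq_curve_length _ f) ?pf// => u /[!in_itv]/= /andP[_ ut].
  by rewrite paste_left// (le_trans ut).
have G s t : c <= s -> s <= t -> t <= b ->
    curve_length (paste c f g) s t = (t - s)%:E.
  move=> *; rewrite (@eq_curve_length _ g) ?pg// => u /[!in_itv]/= /andP[su _].
  by rewrite paste_right// (le_trans _ su).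
move=> s t as_ st tb.
have [tc|ct] := leP t c; first by rewrite L.
have [sc|cs] := leP s c; last by rewrite G ?(ltW cs).
have -> : t - s = (c - s) + (t - c) by ring.
by apply: (@curve_lengthD_ge _ _ _ c); [rewrite L|rewrite G// ltW].
Qed.

Lemma param_by_arc_length_shift g a b k : nonexpansive g ->
  param_by_arc_length g (a + k) (b + k) ->
  param_by_arc_length (g \o +%R^~ k) a b.
Proof.
move=> gn pg; apply: param_by_arc_length_nonexpansive.
  by move=> u v; rewrite (le_trans (gn _ _))//= opprD addrACA subrr addr0.
move=> s t as_ st tb; apply: le_trans (curve_length_shift_ge _ _ _ _).
have -> : t - s = (t + k) - (s + k) by ring.
by rewrite pg ?lerD2r.
Qed.

Lemma param_by_arc_length_sub g a b s t : a <= s -> t <= b ->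
  param_by_arc_length g a b -> param_by_arc_length g s t.
Proof.
move=> as_ tb pg u v su uv vt; apply: pg => //.
- exact: le_trans su.
- exact: le_trans vt tb.
Qed.

Lemma param_by_arc_length_dist g a b s t : a <= s -> s <= t -> t <= b ->
  param_by_arc_length g a b -> `|g t - g s| <= t - s.
Proof. by move=> ? ? ? pg; rewrite -lee_fin -pg// curve_length_ge_dist. Qed.

(** The line through x with direction e, at x for the parameter c.  It has unit
    speed when e is a unit vector. *)
Definition line (x e : X) c : R -> X := fun u => x + (u - c) *: e.

Lemma line_dist x e c u v : `|e| = 1 -> `|line x e c u - line x e c v| = `|u - v|.
Proof.
move=> e1; rewrite /line opprD addrACA subrr add0r -scalerBl normrZ e1 mulr1.
by congr (`|_|); ring.
Qed.

Lemma nonexpansive_line x e c : `|e| = 1 -> nonexpansive (line x e c).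
Proof. by move=> e1 u v; rewrite line_dist. Qed.

Lemma param_by_arc_length_line x e c a b : `|e| = 1 ->
  param_by_arc_length (line x e c) a b.
Proof.
move=> e1; apply: param_by_arc_length_nonexpansive; first exact: nonexpansive_line.
move=> s t _ st _; apply: le_trans (curve_length_ge_dist _ st).
by rewrite lee_fin line_dist// ler_norm.
Qed.

Lemma injective_line x e c a b : `|e| = 1 -> {in `[a, b] &, injective (line x e c)}.
Proof.
move=> e1 u v _ _ /eqP; rewrite -subr_eq0 -normr_eq0 line_dist// normr_eq0 subr_eq0.
by move/eqP.
Qed.

End CurveLength.

(** * Integrals of continuous functions over segments *)

Section IntervalIntegral.
Context {R : realType}.
Implicit Types (f : R -> R) (a b c k x y M : R).
Notation mu := (@lebesgue_measure R).

Lemma within_continuous_subitv f a b x y : a <= x -> y <= b ->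
  {within `[a, b], continuous f} -> {within `[x, y], continuous f}.
Proof.
move=> ax yb; apply: continuous_subspaceW => u /=; rewrite !in_itv/=.
by move=> /andP[xu uy]; rewrite (le_trans ax xu) (le_trans uy yb).
Qed.

Lemma within_continuous_integrable f a b : {within `[a, b], continuous f} ->
  mu.-integrable `[a, b] (EFin \o f).
Proof. by move=> cf; apply: continuous_compact_integrable => //; apply: segment_compact. Qed.

Lemma Rintegral_itv_split f a c b : a <= c -> c <= b ->
  {within `[a, b], continuous f} ->
  (\int[mu]_(u in `[a, b]) f u)%R =
  (\int[mu]_(u in `[a, c]) f u)%R + (\int[mu]_(u in `[c, b]) f u)%R.
Proof.
move=> ac cb cf.
have /esym E := @Rintegral_itvB _ f (BLeft a) (BRight b) c
  (within_continuous_integrable cf) ac cb.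
rewrite Rintegral_itv_obnd_cbnd in E.
  by rewrite E addrC subrK.
apply: integrableS (within_continuous_integrable (within_continuous_subitv ac (lexx b) cf)) => //.
by apply: subset_itvr; rewrite bnd_simp.
Qed.

Lemma le_Rintegral_cst f a b M : a <= b -> {within `[a, b], continuous f} ->
  {in `[a, b], forall u, f u <= M} ->
  (\int[mu]_(u in `[a, b]) f u)%R <= M * (b - a).
Proof.
move=> ab cf fM.
have -> : M * (b - a) = (\int[mu]_(u in `[a, b]) (cst M) u)%R.
  by rewrite Rintegral_cst//= lebesgue_measure_itv/= lte_fin;
     case: ltgtP ab => // ->; rewrite subrr.
apply: le_Rintegral => //; first exact: within_continuous_integrable.
apply: within_continuous_integrable; apply: continuous_subspaceT.
exact: cst_continuous.
Qed.

Lemma ge_Rintegral_cst f a b M : a <= b -> {within `[a, b], continuous f} ->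
  {in `[a, b], forall u, M <= f u} ->
  M * (b - a) <= (\int[mu]_(u in `[a, b]) f u)%R.
Proof.
move=> ab cf fM.
have -> : M * (b - a) = (\int[mu]_(u in `[a, b]) (cst M) u)%R.
  by rewrite Rintegral_cst//= lebesgue_measure_itv/= lte_fin;
     case: ltgtP ab => // ->; rewrite subrr.
apply: le_Rintegral => //; last exact: within_continuous_integrable.
apply: within_continuous_integrable; apply: continuous_subspaceT.
exact: cst_continuous.
Qed.

Lemma integral_itv_shift f a b k : a <= b ->
  {within `[a + k, b + k], continuous f} ->
  (\int[mu]_(u in `[(a + k)%R, (b + k)%R]) (f u)%:E)%E =
  (\int[mu]_(u in `[a, b]) (f (u + k)%R)%:E)%E.
Proof.
move=> ab cf.
have d1 : derive1 (fun u => u + k) = cst 1.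
  by apply/funext => u; rewrite derive1E; have /= -> := congr1 (@^~ u) (derive_shift (1 : R) k).
rewrite (@integration_by_substitution_increasing _ (fun u => u + k)) => //.
- by apply: eq_integral => u _; rewrite d1/= mulr1.
- by move=> u v _ _ uv; rewrite ltrD2r.
- by rewrite d1 => u _; exact: cst_continuous.
- by rewrite d1; exact: is_cvg_cst.
- by rewrite d1; exact: is_cvg_cst.
- have cs : continuous (fun u : R => u + k).
    by move=> u; apply: cvgD => //; exact: cvg_cst.
  split; first by move=> u _; by have /(_ u 1) [] := fun u v => is_derive_shift u v k.
  + exact/cvg_at_right_filter/cs.
  + exact/cvg_at_left_filter/cs.
Qed.

End IntervalIntegral.

(** * Distance to the boundary *)

Section Distance.
Context {R : realType} {X : normedModType R}.
Implicit Types (A : set X) (x y : X) (r : R).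

Lemma norm_dist_ge A x r : A !=set0 -> (forall y, A y -> r <= `|x - y|) ->
  r <= norm_dist A x.
Proof.
move=> [y0 Ay0] h; apply: lb_le_inf; first by exists `|x - y0|; exists y0.
by move=> _ [y Ay <-]; exact: h.
Qed.

Lemma norm_dist_le A x y : A y -> norm_dist A x <= `|x - y|.
Proof.
move=> Ay; apply: ge_inf; last by exists y.
by exists 0 => _ [z _ <-].
Qed.

(** The distance to a set is 1-Lipschitz. *)
Lemma norm_dist_lip A x y : A !=set0 -> norm_dist A y - `|x - y| <= norm_dist A x.
Proof.
move=> A0; apply: norm_dist_ge => // z Az; rewrite lerBlDr.
apply: le_trans (norm_dist_le y Az) _.
by rewrite -(subrKA x) (le_trans (ler_normD _ _))// addrC (distrC y).
Qed.

Lemma norm_dist_continuous A : A !=set0 -> continuous (norm_dist A).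
Proof.
move=> A0 x; apply/cvgrPdist_lt => e e0; near=> y.
have : `|x - y| < e by near: y; exact: cvgr_dist_lt.
have := norm_dist_lip x y A0; have := norm_dist_lip y x A0; rewrite (distrC y) => h1 h2.
by apply: le_lt_trans; rewrite ler_norml; apply/andP; split; lra.
Unshelve. all: by end_near. Qed.

(** Otherwise A would be clopen in a connected space. *)
Lemma boundary_neq0 A : open A -> A !=set0 -> A <> setT -> boundary A !=set0.
Proof.
move=> oA [x Ax] AT; apply/set0P/negP => /eqP bA; apply: AT.
have cA : closed A.
  move=> z clz; apply: contrapT => Az.
  suff : boundary A z by rewrite bA.
  by split => // /interior_subset.
apply/seteqP; split => // y _.
pose f (r : R) := x + r *: (y - x).
have cf : continuous f.
  by move=> r; apply: cvgD; [exact: cvg_cst|exact: cvgZr_tmp].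
have /connected_intervalP cT : is_interval [set: R] by [].
have : f @^-1` A = setT.
  apply: cT.
  - by exists 0; rewrite /f/= scale0r addr0.
  - by exists (f @^-1` A); rewrite ?setTI//; apply: open_comp.
  - by exists (f @^-1` A); rewrite ?setTI//; apply: preimage_closed.
by move/seteqP => [_ /(_ 1 I)]; rewrite /= /f scale1r addrC subrK.
Qed.

Lemma ball_norm_dist_boundary A x r : open A -> boundary A !=set0 ->
  ball x r `<=` A -> r <= norm_dist (boundary A) x.
Proof.
move=> oA bA xA; apply: norm_dist_ge => // y [_ iy]; rewrite leNgt.
apply/negP => xy; apply: iy; rewrite (interior_id A).1//; apply: xA.
by rewrite -ball_normE.
Qed.

Lemma norm_dist_boundary_gt0 A x : open A -> boundary A !=set0 -> A x ->
  0 < norm_dist (boundary A) x.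
Proof.
move=> oA bA Ax; have /nbhs_ballP[r /= r0 xA] : nbhs x A.
  by apply: open_nbhs_nbhs.
exact: lt_le_trans r0 (ball_norm_dist_boundary oA bA xA).
Qed.

End Distance.

(** * Quasihyperbolic length of arcs of unit speed *)

Section UnitArc.
Context {R : realType} {X : normedModType R}.
Variable Omega : set X.
Implicit Types (f g : R -> X) (a b c : R).

(** An arc of Omega parametrized by arc length on [a, b].  The Lipschitz bound
    is required on the whole line, so that g is continuous everywhere; the other
    conditions only concern [a, b]. *)
Definition unit_arc g a b := [/\ a <= b, nonexpansive g,
  param_by_arc_length g a b, {in `[a, b] &, injective g} &
  forall u, u \in `[a, b] -> Omega (g u)].

Lemma unit_arc_rectifiable g a b : unit_arc g a b -> rectifiable_arc Omega g a b.
Proof.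
move=> [ab gn pg gi gO]; split => //.
- by apply: continuous_subspaceT; exact: nonexpansive_continuous.
- by move=> _ [u ug <-]; exact: gO.
- by rewrite pg// ltry.
Qed.

Lemma unit_arc_sub g a b s t : a <= s -> s <= t -> t <= b ->
  unit_arc g a b -> unit_arc g s t.
Proof.
move=> as_ st tb [ab gn pg gi gO].
have sub : {subset `[s, t] <= `[a, b]}.
  move=> u /[!in_itv]/= /andP[su ut].
  by rewrite (le_trans as_ su) (le_trans ut tb).
split => //; first exact: param_by_arc_length_sub pg.
- by move=> u v /sub ua /sub va; exact: gi.
- by move=> u /sub; exact: gO.
Qed.

(** The concatenation of two arcs is an arc when they meet only at the
    junction. *)
Lemma unit_arc_paste c f g a b : f c = g c ->
  {in `[a, c] & `[c, b], forall u v, f u = g v -> u = c \/ v = c} ->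
  unit_arc f a c -> unit_arc g c b -> unit_arc (paste c f g) a b.
Proof.
move=> fg cross [ac fn pf fi fO] [cb gn pg gi gO].
have cL : c \in `[a, c] by rewrite in_itv/= ac lexx.
have cR : c \in `[c, b] by rewrite in_itv/= cb lexx.
split => //.
- exact: le_trans cb.
- exact: nonexpansive_paste.
- exact: param_by_arc_length_paste.
- have X' u v : u \in `[a, c] -> v \in `[c, b] -> f u = g v -> u = v.
    move=> uI vI e; have [uc|vc] := cross _ _ uI vI e.
      by rewrite uc; apply: gi => //; rewrite -fg -uc.
    by rewrite vc; apply: fi => //; rewrite fg -vc.
  move=> u v /[!in_itv]/= /andP[au ub] /andP[av vb].
  have [uc|/ltW cu] := leP u c; have [vc|/ltW cv] := leP v c.
  + by rewrite !paste_left//; apply: fi; rewrite in_itv/= ?au ?av.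
  + by rewrite paste_left// paste_right//; apply: X'; rewrite in_itv/= ?au ?cv.
  + rewrite paste_right// paste_left// => /esym/X' ->//; rewrite in_itv/= ?av ?cu//.
  + by rewrite !paste_right//; apply: gi; rewrite in_itv/= ?cu ?cv.
- move=> u /[!in_itv]/= /andP[au ub]; have [uc|/ltW cu] := leP u c.
  + by rewrite paste_left//; apply: fO; rewrite in_itv/= au.
  + by rewrite paste_right//; apply: gO; rewrite in_itv/= cu.
Qed.

Lemma unit_arc_shift g a b k : unit_arc g (a + k) (b + k) ->
  unit_arc (g \o +%R^~ k) a b.
Proof.
move=> [ab gn pg gi gO].
have tr u : u \in `[a, b] -> u + k \in `[(a + k), (b + k)].
  by rewrite !in_itv/= !lerD2r.
split => //.
- by rewrite lerD2r in ab.
- by move=> u v; rewrite (le_trans (gn _ _))//= opprD addrACA subrr addr0.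
- exact: param_by_arc_length_shift.
- by move=> u v ua va e; apply: (addIr k); apply: gi => //; exact: tr.
- by move=> u ua; apply: gO; exact: tr.
Qed.

(** The density of the quasihyperbolic length along a curve. *)
Definition qh_density g : R -> R := fun u => (norm_dist (boundary Omega) (g u))^-1.

Hypotheses (oO : open Omega) (bO : boundary Omega !=set0).

Lemma qh_density_ge0 g u : 0 <= qh_density g u.
Proof.
by rewrite invr_ge0; apply: norm_dist_ge.
Qed.

Lemma qh_density_continuous g a b : unit_arc g a b ->
  {within `[a, b], continuous (qh_density g)}.
Proof.
move=> [_ gn _ _ gO]; apply: continuous_in_subspaceT => u /set_mem/= ua.
apply: cvgV; first by rewrite gt_eqF// norm_dist_boundary_gt0//; exact: gO.
apply: (@continuous_comp _ _ _ g (norm_dist _)).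
  exact: nonexpansive_continuous.
exact: norm_dist_continuous.
Qed.

(** For a curve parametrized by arc length on [a, b], the parameters at which
    the length from a has reached s are those of [s + a, b]. *)
Lemma arc_length_reparam_unit g a b s : param_by_arc_length g a b ->
  0 <= s <= b - a -> arc_length_reparam g a b s = g (s + a).
Proof.
move=> pg /andP[s0 sb]; rewrite /arc_length_reparam.
have E : [set t : R | t \in `[a, b] /\ (s%:E <= curve_length g a t)%E] =
    [set` `[s + a, b]].
  apply/seteqP; split => t /=; rewrite !in_itv/=.
    by move=> [/andP[at_ tb]]; rewrite pg// lee_fin tb andbT -lerBrDr.
  move=> /andP[st tb]; have at_ : a <= t by lra.
  by rewrite at_ tb pg// lee_fin lerBrDr.
by rewrite E inf_itvcc// -lerBrDr.
Qed.

Lemma qh_length_unit_arc g a b : unit_arc g a b ->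
  qh_length Omega g a b =
  (\int[@lebesgue_measure R]_(u in `[a, b]) qh_density g u)%R%:E.
Proof.
move=> ga; have [ab gn pg gi gO] := ga.
have cd := qh_density_continuous ga.
rewrite /qh_length /arc_integral pg//= fineK; last first.
  apply: integrable_fin_num => //; exact: within_continuous_integrable.
have ab0 : 0 <= b - a by rewrite subr_ge0.
have e : (0 + a = a) * (b - a + a = b) by rewrite add0r subrK.
have /= := integral_itv_shift ab0 (f := qh_density g) (k := a).
rewrite !e => -> //; apply: eq_integral => s /set_mem/=; rewrite in_itv/= => sI.
by rewrite (arc_length_reparam_unit pg).
Qed.

End UnitArc.

(** * Replacing a piece of a minimizing arc by its chord *)

Lemma closed_itv_max (R : realType) (S : set R) (x y z : R) :
  closed S -> S z -> z \in `[x, y] ->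
  exists m, [/\ S m, m \in `[x, y] & forall w, S w -> w \in `[x, y] -> w <= m].
Proof.
move=> cS Sz zxy.
have [||| m] := @compact_EVT_max R R id (`[x, y] `&` S).
- by exists z.
- by apply: compact_closedI => //; exact: segment_compact.
- by apply: continuous_subspaceT => u; exact: cvg_id.
move=> /set_mem[/= mxy Sm] mmax; exists m; split => // w Sw wxy.
by apply: mmax; rewrite inE.
Qed.

Lemma closed_itv_min (R : realType) (S : set R) (x y z : R) :
  closed S -> S z -> z \in `[x, y] ->
  exists m, [/\ S m, m \in `[x, y] & forall w, S w -> w \in `[x, y] -> m <= w].
Proof.
move=> cS Sz zxy.
have [||| m] := @compact_EVT_min R R id (`[x, y] `&` S).
- by exists z.
- by apply: compact_closedI => //; exact: segment_compact.
- by apply: continuous_subspaceT => u; exact: cvg_id.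
move=> /set_mem[/= mxy Sm] mmax; exists m; split => // w Sw wxy.
by apply: mmax; rewrite inE.
Qed.

Section Chord.
Context {R : realType} {X : normedModType R}.
Variable Omega : set X.
Hypotheses (oO : open Omega) (bO : boundary Omega !=set0).
Implicit Types (f g : R -> X) (a b c : R).

Notation J g a b := (\int[@lebesgue_measure R]_(u in `[a, b]) qh_density Omega g u)%R.

Lemma closed_meets_arc f g a b : continuous f -> continuous g ->
  closed [set r | exists2 u, u \in `[a, b] & f u = g r].
Proof.
move=> cf cg.
have -> : [set r | exists2 u, u \in `[a, b] & f u = g r] =
    g @^-1` (f @` [set` `[a, b]]) by [].
apply: preimage_closed; first by move=> x _; exact: cg.
apply: compact_closed; first exact: norm_hausdorff.
by apply: continuous_compact; [exact: continuous_subspaceT|exact: segment_compact].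
Qed.

(** Loop erasure.  The chord r |-> g s + r e runs from g s to g t as r runs over
    [0, rho].  Let r0 be its last parameter in g [a, s], hit at g s0, and r1 the
    first parameter after r0 in g [t, b], hit at g t1.  Then g on [a, s0], the
    chord on [r0, r1] and g on [t1, b] meet only at their junctions. *)
Lemma chord_erasure g a b s t e rho :
  nonexpansive g -> {in `[a, b] &, injective g} ->
  a <= s -> s < t -> t <= b -> `|e| = 1 -> 0 <= rho -> g t = g s + rho *: e ->
  exists s0 t1 r0 r1,
  [/\ [/\ a <= s0, s0 <= s, t <= t1 & t1 <= b],
      [/\ 0 <= r0, r0 <= r1 & r1 <= rho],
      g s0 = g s + r0 *: e /\ g t1 = g s + r1 *: e,
      forall u r, a <= u -> u <= s0 -> r0 <= r -> r <= r1 ->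
        g u = g s + r *: e -> r = r0 &
      forall u r, t1 <= u -> u <= b -> r0 <= r -> r <= r1 ->
        g u = g s + r *: e -> r = r1].
Proof.
move=> gn gi as_ st tb e1 rho0 gt.
have cg := nonexpansive_continuous gn.
pose L := line (g s) e 0.
have LE r : L r = g s + r *: e by rewrite /L /line subr0.
have cL : continuous L by apply/nonexpansive_continuous/nonexpansive_line.
have [] := @closed_itv_max _ _ 0 rho 0 (@closed_meets_arc g L a s cg cL).
- by exists s; rewrite ?LE ?scale0r ?addr0// in_itv/= as_ lexx.
- by rewrite in_itv/= lexx.
move=> r0 [[s0 /[!in_itv]/= /andP[as0 s0s] gs0] /andP[r00 r0rho] r0max].
have [] := @closed_itv_min _ _ r0 rho rho (@closed_meets_arc g L t b cg cL).
- by exists t; rewrite ?LE// in_itv/= tb lexx.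
- by rewrite in_itv/= lexx r0rho.
move=> r1 [[t1 /[!in_itv]/= /andP[tt1 t1b] gt1] /andP[r0r1 r1rho] r1min].
exists s0, t1, r0, r1; rewrite gs0 gt1 !LE; split => //.
- move=> u r au us0 rr0 rr1 gu; apply/eqP; rewrite eq_le rr0 andbT.
  apply: r0max; last by rewrite in_itv/= (le_trans r00)// (le_trans rr1).
  by exists u; rewrite ?LE// in_itv/= au (le_trans us0).
- move=> u r t1u ub rr0 rr1 gu; apply/eqP; rewrite eq_le rr1/=.
  apply: r1min; last by rewrite in_itv/= rr0 (le_trans rr1).
  by exists u; rewrite ?LE// in_itv/= ub (le_trans tt1).
Qed.

Lemma qh_density_shift g a b k : unit_arc Omega g (a + k) (b + k) ->
  J (g \o +%R^~ k) a b = J g (a + k) (b + k).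
Proof.
move=> ga; rewrite /Rintegral; congr fine.
have [ab _ _ _ _] := ga; rewrite lerD2r in ab.
by rewrite integral_itv_shift//; exact: qh_density_continuous.
Qed.

Lemma eq_qh_density f g a b : {in `[a, b], f =1 g} -> J f a b = J g a b.
Proof.
by move=> fg; apply: eq_Rintegral => u /set_mem/= uab; rewrite /qh_density fg.
Qed.

Lemma qh_density_split g a b c : unit_arc Omega g a b -> a <= c -> c <= b ->
  J g a b = J g a c + J g c b.
Proof. by move=> ga ac cb; apply: Rintegral_itv_split => //; exact: qh_density_continuous. Qed.

Lemma qh_density_int_ge0 g a b : 0 <= J g a b.
Proof. by apply: Rintegral_ge0 => *; exact: qh_density_ge0. Qed.

(** Minimality of g on [a, b] among the arcs of unit speed that join the same
    points; such arcs may be assumed to start at the parameter a. *)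
Definition qh_minimizing g a b := forall f b', unit_arc Omega f a b' ->
  f a = g a -> f b' = g b -> J g a b <= J f a b'.

(** A piece of a minimizing arc is not longer than some subsegment of its
    chord, in the quasihyperbolic sense. *)
Lemma qh_minimizing_chord g a b s t e rho : unit_arc Omega g a b ->
  qh_minimizing g a b ->
  a <= s -> s < t -> t <= b -> `|e| = 1 -> 0 <= rho -> g t = g s + rho *: e ->
  (forall r, 0 <= r -> r <= rho -> Omega (g s + r *: e)) ->
  exists r0 r1, [/\ 0 <= r0, r0 <= r1, r1 <= rho &
    J g s t <= J (line (g s) e 0) r0 r1].
Proof.
move=> ga gmin as_ st tb e1 rho0 gt LO; have [ab gn pg gi gO] := ga.
have [s0 [t1 [r0 [r1 [[as0 s0s tt1 t1b] [r00 r01 r1rho] [gs0 gt1] C1 C2]]]]] :=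
  chord_erasure gn gi as_ st tb e1 rho0 gt.
exists r0, r1; split => //.
pose L := line (g s) e 0.
have LE r : L r = g s + r *: e by rewrite /L /line subr0.
have uL : unit_arc Omega L r0 r1.
  split => //; first exact: nonexpansive_line.
  - exact: param_by_arc_length_line.
  - exact: injective_line.
  - by move=> u /[!in_itv]/= /andP[r0u ur1]; rewrite LE; apply: LO; lra.
(* The competitor is g on [a, s0], the chord shifted by k1 on [s0, c], and g
   shifted by k2 on [c, b']. *)
pose k1 := r0 - s0; pose c := r1 - k1; pose k2 := t1 - c; pose b' := b - k2.
have s0k1 : s0 + k1 = r0 by rewrite /k1; ring.
have ck1 : c + k1 = r1 by rewrite /c; ring.
have ck2 : c + k2 = t1 by rewrite /k2; ring.
have b'k2 : b' + k2 = b by rewrite /b'; ring.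
have s0c : s0 <= c by rewrite -(lerD2r k1) s0k1 ck1.
have cb' : c <= b' by rewrite -(lerD2r k2) ck2 b'k2.
pose g1 := L \o +%R^~ k1; pose g2 := g \o +%R^~ k2.
have e2 : g1 c = g2 c by rewrite /g1 /g2 /= ck1 ck2 LE.
pose f1 := paste c g1 g2.
have e1' : g s0 = f1 s0 by rewrite /f1 paste_left// /g1/= s0k1 LE.
have u1 : unit_arc Omega g1 s0 c by apply: unit_arc_shift; rewrite s0k1 ck1.
have u2 : unit_arc Omega g2 c b'.
  by apply: unit_arc_shift; rewrite ck2 b'k2; apply: unit_arc_sub ga => //; lra.
have u0 : unit_arc Omega g a s0 by apply: unit_arc_sub ga => //; lra.
have uf1 : unit_arc Omega f1 s0 b'.
  apply: unit_arc_paste => // u v /[!in_itv]/= /andP[u1' u2'] /andP[v1 v2] E; left.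
  apply: (addIr k1); rewrite ck1; apply: (C2 (v + k2)).
  - by rewrite -ck2 lerD2r.
  - by rewrite -b'k2 lerD2r.
  - by rewrite -s0k1 lerD2r.
  - by rewrite -ck1 lerD2r.
  - by rewrite -LE; exact/esym.
have uf : unit_arc Omega (paste s0 g f1) a b'.
  apply: unit_arc_paste => // u v /[!in_itv]/= /andP[au us0] /andP[v1 v2].
  have [vc|cv] := leP v c.
    rewrite /f1 paste_left// => E; right.
    apply: (addIr k1); rewrite s0k1; apply: (C1 u) => //.
    - by rewrite -s0k1 lerD2r.
    - by rewrite -ck1 lerD2r.
    - by rewrite -LE.
  rewrite /f1 paste_right// ?(ltW cv)// /g2/= => E.
  have E' : u = v + k2.
    apply: gi => //; rewrite in_itv/=.
      by rewrite au; lra.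
    by rewrite -b'k2 lerD2r v2 andbT; lra.
  by lra.
have := gmin _ _ uf.
have as0c : a <= c by lra.
rewrite paste_left// paste_right//; last exact: le_trans cb'.
rewrite /f1 paste_right// {1}/g2/= b'k2 => /(_ erefl erefl).
rewrite (qh_density_split uf as0) ?(le_trans s0c)//.
rewrite (@eq_qh_density (paste s0 g f1) g); last first.
  by move=> u /[!in_itv]/= /andP[_ us0]; rewrite paste_left.
rewrite (@eq_qh_density (paste s0 g f1) f1 s0); last first.
  by move=> u /[!in_itv]/= /andP[us0 _]; rewrite paste_right.
rewrite (qh_density_split uf1 s0c cb').
rewrite (@eq_qh_density f1 g1 s0); last first.
  by move=> u /[!in_itv]/= /andP[_ us0]; rewrite /f1 paste_left.
rewrite (@eq_qh_density f1 g2 c); last first.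
  by move=> u /[!in_itv]/= /andP[us0 _]; rewrite /f1 paste_right.
rewrite qh_density_shift ?s0k1 ?ck1// qh_density_shift ?ck2 ?b'k2//; last first.
  by apply: unit_arc_sub ga => //; lra.
have s0t1 : s0 <= t1 by lra.
have s0b : s0 <= b by lra.
have uS : unit_arc Omega g s0 b by apply: unit_arc_sub ga => //; lra.
have uS' : unit_arc Omega g s b by apply: unit_arc_sub ga => //; lra.
have uS'' : unit_arc Omega g t b by apply: unit_arc_sub ga => //; lra.
rewrite (qh_density_split ga as0 s0b) (qh_density_split uS s0s); last by lra.
rewrite (qh_density_split uS' (ltW st) tb) (qh_density_split uS'' tt1 t1b).
have := qh_density_int_ge0 g s0 s; have := qh_density_int_ge0 g t t1.
rewrite -/L; lra.
Qed.

(** The chord of a short piece of a minimizing arc is almost as long as the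
    piece itself. *)
Lemma qh_minimizing_chord_ge g a b s t :
  unit_arc Omega g a b -> qh_minimizing g a b ->
  a <= s -> s < t -> t <= b ->
  let d := norm_dist (boundary Omega) (g s) in
  ball (g s) (2 * (t - s)) `<=` Omega ->
  (t - s) - 2 / d * (t - s) ^+ 2 <= `|g t - g s|.
Proof.
move=> ga gmin as_ st tb d bO'; have [ab gn pg gi gO] := ga.
have h0 : 0 < t - s by rewrite subr_gt0.
set h := t - s in h0 bO' *.
have d2h : 2 * h <= d by exact: ball_norm_dist_boundary.
have d0 : 0 < d by lra.
have sI : s \in `[a, b] by rewrite in_itv/= as_; lra.
have tI : t \in `[a, b] by rewrite in_itv/= tb andbT; lra.
set rho := `|g t - g s|.
have rhoh : rho <= h by apply: param_by_arc_length_dist pg => //; exact: ltW.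
have rho0 : 0 < rho.
  rewrite normr_gt0 subr_eq0; apply/eqP => /(gi _ _ tI sI) ts.
  by move: st; rewrite ts ltxx.
pose e := rho^-1 *: (g t - g s).
have e1 : `|e| = 1.
  by rewrite normrZ ger0_norm ?invr_ge0 ?(ltW rho0)// mulVf// gt_eqF.
have gt : g t = g s + rho *: e.
  by rewrite /e scalerA divff ?gt_eqF// scale1r addrC subrK.
have near r : 0 <= r -> r <= h -> d - h <= norm_dist (boundary Omega) (g s + r *: e).
  move=> r0 rh; have := norm_dist_lip (g s + r *: e) (g s) bO.
  by rewrite -/d [g s + _]addrC addrK normrZ e1 mulr1 (ger0_norm r0); lra.
have LO r : 0 <= r -> r <= rho -> Omega (g s + r *: e).
  move=> r0 rh; apply: bO'; rewrite -ball_normE/= opprD addNKr normrN normrZ e1.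
  by rewrite mulr1 ger0_norm//; lra.
have [r0 [r1 [r00 r01 r1rho JJ]]] :=
  qh_minimizing_chord ga gmin as_ st tb e1 (ltW rho0) gt LO.
have uL : unit_arc Omega (line (g s) e 0) r0 r1.
  split => //; first exact: nonexpansive_line.
  - exact: param_by_arc_length_line.
  - exact: injective_line.
  - by move=> u /[!in_itv]/= /andP[r0u ur1]; rewrite /line subr0; apply: LO; lra.
have ug : unit_arc Omega g s t by apply: unit_arc_sub ga => //; exact: ltW.
(* Density bounds 1/(d - h) on the chord and 1/(d + h) on the arc. *)
have hi : J (line (g s) e 0) r0 r1 <= (d - h)^-1 * (r1 - r0).
  apply: le_Rintegral_cst => //; first exact: qh_density_continuous.
  move=> u /[!in_itv]/= /andP[r0u ur1].
  rewrite /qh_density /line subr0 lef_pV2 ?posrE.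
  - by apply: near; lra.
  - by apply: lt_le_trans (near _ _ _); lra.
  - by lra.
have lo : (d + h)^-1 * (t - s) <= J g s t.
  apply: ge_Rintegral_cst; [exact: ltW|exact: qh_density_continuous|].
  move=> u /[!in_itv]/= /andP[su ut].
  have dl := norm_dist_lip (g s) (g u) bO.
  have gus : `|g u - g s| <= h.
    apply: le_trans (gn u s) _; rewrite ger0_norm ?subr_ge0// /h; lra.
  have uI : u \in `[a, b] by rewrite in_itv/=; apply/andP; split; lra.
  rewrite /qh_density lef_pV2 ?posrE.
  - by move: dl; rewrite -/d distrC; lra.
  - by lra.
  - by apply: norm_dist_boundary_gt0 => //; exact: gO.
have key : (d + h)^-1 * h <= (d - h)^-1 * rho.
  apply: le_trans lo _; apply: le_trans JJ _; apply: le_trans hi _.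
  by rewrite ler_wpM2l ?invr_ge0; lra.
have key2 : h * (d - h) <= rho * (d + h).
  move: key; rewrite mulrC (mulrC _ rho) ler_pdivrMr; last by lra.
  by rewrite mulrAC ler_pdivlMr; lra.
have : (h - 2 / d * h ^+ 2) * (d + h) <= h * (d - h).
  have -> : (h - 2 / d * h ^+ 2) * (d + h) = h * (d - h) - 2 / d * h ^+ 3.
    by field; rewrite gt_eqF.
  have : 0 <= 2 / d * h ^+ 3.
    by apply: mulr_ge0; [apply: divr_ge0; lra|apply: exprn_ge0; lra].
  lra.
move=> /le_trans /(_ key2); rewrite ler_pM2r//; lra.
Qed.

End Chord.

(** * Convexity of power type on the unit ball *)

Section Convexity.
Context {R : realType} {X : normedModType R}.
Implicit Types (x y : X).

Lemma norm_normalize x : 0 < `|x| <= 1 ->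
  `| `|x|^-1 *: x | = 1 /\ `|x - `|x|^-1 *: x| = 1 - `|x|.
Proof.
move=> /andP[x0 x1]; have xn : `|x| != 0 by rewrite gt_eqF.
split; first by rewrite normrZ ger0_norm ?invr_ge0// mulVf.
rewrite -{1}[x]scale1r -scalerBl normrZ -{2}[`|x|]normr_id -normrM mulrBl mul1r.
by rewrite mulVf// distrC ger0_norm// subr_ge0.
Qed.

Lemma modulus_convexity_le x y : `|x| = 1 -> `|y| = 1 ->
  modulus_convexity X `|x - y| <= 1 - `|x + y| / 2.
Proof.
move=> x1 y1; apply: ge_inf; last by exists x, y.
exists 0 => _ [u [v [u1 v1 _ ->]]].
by have := ler_normD u v; rewrite u1 v1; lra.
Qed.

(** Power type convexity is stated for unit vectors; here it is extended to the
    unit ball: if the midpoint of x and y has norm at least 1 - eta, then |x|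
    and |y| are at least 1 - 2 eta, and normalizing x and y moves each of them
    by at most 2 eta. *)
Lemma power_type_unit_ball : power_type_convexity X ->
  exists K theta : R, [/\ 0 < K, 0 < theta &
    forall x y (eta : R), `|x| <= 1 -> `|y| <= 1 -> 0 <= eta ->
      2 * (1 - eta) <= `|x + y| -> `|x - y| <= K * eta `^ theta].
Proof.
move=> [p [c [p2 c0 hp]]].
have p0 : 0 < p by lra.
have th0 : 0 < p^-1 by rewrite invr_gt0.
have th1 : p^-1 <= 1 by rewrite invf_le1//; lra.
have K0 : 0 <= (3 / c) `^ p^-1 by exact: powR_ge0.
exists (8 + (3 / c) `^ p^-1), p^-1; split => //; first by lra.
move=> x y eta x1 y1 eta0 hxy.
have pw0 := powR_ge0 eta p^-1.
have etaw : eta <= 1 -> eta <= eta `^ p^-1.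
  move=> e1; move: eta0; rewrite le_eqVlt => /predU1P[<-|e0].
    exact: powR_ge0.
  by apply: ger1_powR => //; rewrite e0.
(* For large eta the trivial bound |x - y| <= 2 suffices. *)
have [eta4|eta4] := leP 4^-1 eta.
  have : `|x - y| <= 2 by apply: le_trans (ler_normB _ _) _; lra.
  have : 4^-1 <= eta `^ p^-1.
    have [/etaw e1|/ltW e1] := leP eta 1; first exact: le_trans e1.
    by apply: le_trans (ler_powR e1 (ltW th0)); rewrite powRr0; lra.
  have : 0 <= (3 / c) `^ p^-1 * eta `^ p^-1 by exact: mulr_ge0.
  by rewrite mulrDl; lra.
have {}etaw := etaw ltac:(lra).
have hn := ler_normD x y.
have xb : 0 < `|x| <= 1 by apply/andP; split; lra.
have yb : 0 < `|y| <= 1 by apply/andP; split; lra.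
have [x'1 xx'] := norm_normalize xb; have [y'1 yy'] := norm_normalize yb.
set x' := _ *: x in x'1 xx'; set y' := _ *: y in y'1 yy'.
have hs : `|x + y| <= `|x' + y'| + (`|x - x'| + `|y - y'|).
  have -> : x + y = (x' + y') + ((x - x') + (y - y')).
    by rewrite addrACA (addrC x') (addrC y') !subrK.
  apply: le_trans (ler_normD _ _) _; rewrite lerD2l; exact: ler_normD.
have hd : `|x - y| <= `|x' - y'| + (`|x - x'| + `|y - y'|).
  have -> : x - y = (x' - y') + ((x - x') - (y - y')).
    by rewrite opprB addrACA (addrC x') subrK (addrC (- y')) addrAC subrr add0r.
  apply: le_trans (ler_normD _ _) _; rewrite lerD2l; exact: ler_normB.
suff : `|x' - y'| <= (3 / c) `^ p^-1 * eta `^ p^-1 by rewrite mulrDl; lra.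
have [->|e0] := eqVneq (`|x' - y'|) 0; first exact: mulr_ge0.
have ep : 0 < `|x' - y'| by rewrite lt_neqAle eq_sym e0 normr_ge0.
have e2 : `|x' - y'| <= 2 by apply: le_trans (ler_normB _ _) _; lra.
have h1 := le_trans (hp _ ep e2) (modulus_convexity_le x'1 y'1).
have h2 : `|x' - y'| `^ p <= 3 / c * eta.
  by rewrite mulrAC ler_pdivlMr// mulrC; lra.
rewrite -powRM//; last by apply: divr_ge0; lra.
have -> : `|x' - y'| = (`|x' - y'| `^ p) `^ p^-1.
  by rewrite -powRrM mulfV ?gt_eqF// powRr1.
apply: ge0_ler_powR => //; first exact: ltW.
- by rewrite nnegrE powR_ge0.
- by rewrite nnegrE mulr_ge0// divr_ge0//; lra.
Qed.

(** If a weighted sum of x and y almost attains its maximal norm, then so does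
    their plain sum. *)
Lemma norm_sum_unbalanced x y (l m delta : R) : 0 <= l -> l <= m -> `|y| <= 1 ->
  l + m - delta <= `|l *: x + m *: y| -> l * (2 - `|x + y|) <= delta.
Proof.
move=> l0 lm y1.
have -> : l *: x + m *: y = l *: (x + y) + (m - l) *: y.
  by rewrite scalerDr scalerBl -addrA (addrC (l *: y)) subrK.
move=> h; have := le_trans h (ler_normD _ _).
rewrite !normrZ (ger0_norm l0) (ger0_norm (_ : 0 <= m - l)) ?subr_ge0//.
have : (m - l) * `|y| <= m - l by rewrite ler_piMr ?subr_ge0.
lra.
Qed.

End Convexity.

(** * Comparison of slopes *)

Section Slopes.
Context {R : realType} {X : normedModType R}.
Variables (f : R -> X).
Implicit Types s t m h l : R.

(** The slope of f between s and t, in either order; it is 0 when s = t. *)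
Definition slope s t : X := (t - s)^-1 *: (f t - f s).

Lemma slopeC s t : slope s t = slope t s.
Proof. by rewrite /slope -(opprB t s) invrN scaleNr -scalerN opprB. Qed.

Lemma slope_split s m t : s != m -> m != t -> s != t ->
  slope s t = ((m - s) / (t - s)) *: slope s m + ((t - m) / (t - s)) *: slope m t.
Proof.
move=> sm mt st; rewrite /slope !scalerA.
have e1 : (m - s) / (t - s) * (m - s)^-1 = (t - s)^-1.
  by field; rewrite !subr_eq0 ![_ == s]eq_sym sm st.
have e2 : (t - m) / (t - s) * (t - m)^-1 = (t - s)^-1.
  by field; rewrite !subr_eq0 ![t == _]eq_sym mt st.
by rewrite e1 e2 -scalerDr [X in _ = _ *: X]addrC subrKA.
Qed.

Variables (alpha beta K theta : R).
Hypotheses (K0 : 0 <= K :> R) (theta0 : 0 < theta).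
Hypothesis balanced : forall s m t, alpha < s -> s < m -> m < t -> t < beta ->
  t - s <= 4 * (m - s) -> t - s <= 4 * (t - m) ->
  `|slope s m - slope m t| <= K * (t - s) `^ theta.

Let win u := alpha < u < beta.

Lemma win_between s h l : win s -> win (s + h) -> 0 <= l <= 1 -> win (s + l * h).
Proof.
move=> /andP[s1 s2] /andP[h1 h2] /andP[l0 l1].
have [h0|h0] := leP 0 h.
  have : l * h <= h by rewrite ler_piMl.
  have : 0 <= l * h by exact: mulr_ge0.
  by move=> *; apply/andP; split; lra.
have : h <= l * h by rewrite ler_niMl// ltW.
have : l * h <= 0 by rewrite mulr_ge0_le0// ltW.
by move=> *; apply/andP; split; lra.
Qed.

(** The slope over [s, s + h] is a convex combination of those over the two
    pieces into which s + l h cuts it.  Here h may be negative. *)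
Lemma slope_ratio s h l : win s -> win (s + h) -> h != 0 -> 4^-1 <= l <= 3 / 4 ->
  `|slope s (s + l * h) - slope s (s + h)| <= K * `|h| `^ theta.
Proof.
move=> ws wh h0 /andP[l1 l2].
have wl : win (s + l * h) by apply: win_between => //; apply/andP; split; lra.
have l0 : l != 0 by rewrite gt_eqF//; lra.
have l3 : 1 - l != 0 by rewrite gt_eqF//; lra.
rewrite (@slope_split s (s + l * h) (s + h)); last 3 first.
- by rewrite -subr_eq0 opprD addNKr oppr_eq0 mulf_neq0.
- rewrite -subr_eq0 opprD addrACA subrr add0r -{2}[h]mul1r -mulrBl mulf_neq0//.
  by rewrite subr_eq0 eq_sym -subr_eq0.
- by rewrite -subr_eq0 opprD addNKr oppr_eq0.
have -> : s + h - s = h by ring.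
have -> : (s + l * h - s) / h = l by field.
have -> : (s + h - (s + l * h)) / h = 1 - l by field.
set A := slope _ _; set B := slope _ _.
have -> : A - (l *: A + (1 - l) *: B) = (1 - l) *: (A - B).
  by rewrite opprD addrA -{1}[A]scale1r -scalerBl scalerBr.
rewrite normrZ ger0_norm; last by lra.
apply: (@le_trans _ _ `|A - B|); first by rewrite ler_piMl//; lra.
move: ws wh wl => /andP[s1 s2] /andP[h1 h2] /andP[wl1 wl2].
have [hp|hn] := ltP 0 h.
  have lh : 4^-1 * h <= l * h by rewrite ler_pM2r.
  have lh' : l * h <= 3 / 4 * h by rewrite ler_pM2r.
  have := @balanced s (s + l * h) (s + h).
  by rewrite addrAC subrr add0r gtr0_norm//; apply; lra.
have {}hn : h < 0 by rewrite lt_neqAle h0.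
have lh : l * h <= 4^-1 * h by rewrite ler_nM2r.
have lh' : 3 / 4 * h <= l * h by rewrite ler_nM2r.
have -> : `|h| = s - (s + h) by rewrite ltr0_norm//; ring.
rewrite /A /B (slopeC s (s + l * h)) (slopeC (s + l * h) (s + h)) distrC.
by apply: balanced; lra.
Qed.

(** With q = (1/2)^theta, halving the step n times changes the slope by at most
    the geometric sum of K |h|^theta q^k for k < n; the last cut, in a ratio
    between 1/2 and 1, costs at most 2 K |h|^theta more.  Any K1 with
    K1 (1 - q) >= 3 K absorbs both in an induction on n. *)
Lemma slope_shrink : exists2 K1 : R, 0 <= K1 &
  forall s h l, win s -> win (s + h) -> h != 0 -> 0 < l <= 1 ->
  `|slope s (s + l * h) - slope s (s + h)| <= K1 * `|h| `^ theta.
Proof.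
have q0 : 0 <= 2^-1 `^ theta by exact: powR_ge0.
have q1 : 2^-1 `^ theta < 1.
  have : 2^-1 `^ theta < 1 `^ theta.
    by apply: gt0_ltr_powR => //; rewrite ?nnegrE; lra.
  by rewrite powR1.
have powh h : `|2^-1 * h| `^ theta = 2^-1 `^ theta * `|h| `^ theta.
  by rewrite normrM powRM// ger0_norm//; lra.
move: (2^-1 `^ theta) q0 q1 powh => q q0 q1 powh.
have [K1 K1E] : exists K1 : R, K1 * (1 - q) = 3 * K.
  by exists (3 * K / (1 - q)); rewrite divfK// gt_eqF// subr_gt0.
have K10 : 0 <= K1.
  by rewrite -(pmulr_lge0 _ (_ : 0 < 1 - q)) ?subr_gt0// K1E mulr_ge0//.
have K1K : 3 * K <= K1.
  by rewrite -K1E ler_piMr// gerBl.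
exists K1 => // s h l ws wh h0 /andP[l0 l1].
have [n nl] : exists n, 2^-1 ^+ n <= l.
  have h2 : `|2^-1 : R| < 1 by rewrite ger0_norm; lra.
  have /cvgrPdist_lt/(_ _ l0) [n _ /(_ n (leqnn n))] := cvg_geometric 1 h2.
  rewrite /geometric/= mul1r sub0r normrN => /ltW h'; exists n.
  exact: le_trans (ler_norm _) h'.
elim: n h l h0 wh l0 l1 nl => [|n IH] h l h0 wh l0 l1.
  rewrite expr0 => l1'; have -> : l = 1 by apply/eqP; rewrite eq_le l1.
  by rewrite mul1r subrr normr0 mulr_ge0// powR_ge0.
move=> nl.
have pw := powR_ge0 `|h| theta.
have half : win (s + 2^-1 * h) by apply: win_between => //; apply/andP; split; lra.
have h20 : 2^-1 * h != 0 by rewrite mulf_neq0// gt_eqF//; lra.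
have hb : `|slope s (s + 2^-1 * h) - slope s (s + h)| <= K * `|h| `^ theta.
  by apply: slope_ratio => //; apply/andP; split; lra.
have KK : 3 * K * `|h| `^ theta <= K1 * `|h| `^ theta by rewrite ler_wpM2r.
have Kp : 0 <= K * `|h| `^ theta by exact: mulr_ge0.
have [l2|l2] := leP l 2^-1.
  have := IH (2^-1 * h) (2 * l) h20 half.
  have -> : 2 * l * (2^-1 * h) = l * h by field.
  rewrite powh.
  move=> /(_ _ _ _)/le_trans H.
  have {}H : `|slope s (s + l * h) - slope s (s + 2^-1 * h)| <=
      K1 * (q * `|h| `^ theta).
    apply: H => //; first by lra.
    - by lra.
    - by move: nl; rewrite exprS; lra.
  rewrite -(subrKA (slope s (s + 2^-1 * h))).
  apply: le_trans (ler_normD _ _) _.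
  have : K1 * (1 - q) * `|h| `^ theta = 3 * K * `|h| `^ theta by rewrite K1E.
  by rewrite mulrBr mulr1 mulrBl mulrA in H *; lra.
have [l34|l34] := leP l (3 / 4).
  apply: le_trans (slope_ratio ws wh h0 _) _; last by lra.
  by apply/andP; split; lra.
(* For l close to 1, compare both slopes with the slope over half of h. *)
have lh0 : l * h != 0 by rewrite mulf_neq0// gt_eqF.
have wl : win (s + l * h) by apply: win_between => //; apply/andP; split; lra.
have := @slope_ratio s (l * h) ((2 * l)^-1) ws wl lh0.
have -> : (2 * l)^-1 * (l * h) = 2^-1 * h by field; rewrite gt_eqF.
have lb : 4^-1 <= (2 * l)^-1 <= 3 / 4.
  apply/andP; split; first by rewrite lef_pV2 ?posrE; lra.
  by rewrite -[3 / 4]invrK lef_pV2 ?posrE ?invr_gt0; lra.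
move=> /(_ lb) {lb}; rewrite distrC => h2.
rewrite -(subrKA (slope s (s + 2^-1 * h))).
apply: le_trans (ler_normD _ _) _.
have : K * `|l * h| `^ theta <= K * `|h| `^ theta.
  rewrite ler_wpM2l// ge0_ler_powR ?nnegrE//; first exact: ltW.
  by rewrite normrM ger0_norm ?ler_piMl// ltW.
lra.
Qed.

(** All slopes at s with steps not exceeding h, on either side of s, are close
    to each other. *)
Lemma slope_compare : exists2 K2 : R, 0 <= K2 &
  forall s h h', win s -> win (s + h) -> win (s - h) ->
  h != 0 -> h' != 0 -> `|h'| <= `|h| ->
  `|slope s (s + h') - slope s (s + h)| <= K2 * `|h| `^ theta.
Proof.
have [K1 K10 shrink] := slope_shrink.
exists (K1 + K * 2 `^ theta); first by rewrite addr_ge0// mulr_ge0// powR_ge0.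
move=> s h h' ws wh wnh h0 h'0 hh.
have nh0 : 0 < `|h| by rewrite normr_gt0.
have pw := powR_ge0 `|h| theta.
have K20 : 0 <= K * 2 `^ theta * `|h| `^ theta by rewrite !mulr_ge0// powR_ge0.
rewrite mulrDl.
have lb : 0 < `|h' / h| <= 1.
  by rewrite normr_gt0 mulf_neq0 ?invr_eq0//= normrM normfV ler_pdivrMr// mul1r.
have [l0|l0] := leP 0 (h' / h).
  have := shrink _ _ _ ws wh h0 lb; rewrite ger0_norm// divfK//; lra.
have nhn0 : - h != 0 by rewrite oppr_eq0.
have := shrink _ _ _ ws wnh nhn0 lb.
rewrite ltr0_norm// mulrNN divfK// normrN => H.
suff : `|slope s (s - h) - slope s (s + h)| <= K * 2 `^ theta * `|h| `^ theta.
  move=> H2; rewrite -(subrKA (slope s (s - h))).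
  by apply: le_trans (ler_normD _ _) _; lra.
move: ws wh wnh => /andP[s1 s2] /andP[h1 h2] /andP[wl1 wl2].
rewrite -mulrA -powRM//.
have [hp|hn] := ltP 0 h.
  have := @balanced (s - h) s (s + h); rewrite slopeC gtr0_norm//.
  have -> : s + h - (s - h) = 2 * h by ring.
  by apply; lra.
have {}hn : h < 0 by rewrite lt_neqAle h0.
have := @balanced (s + h) s (s - h); rewrite slopeC distrC ltr0_norm//.
have -> : s - h - (s + h) = 2 * - h by ring.
by apply; lra.
Qed.

End Slopes.

(** * Differentiability from comparison of slopes *)

Section HolderSlopes.
Context {R : realType} {X : completeNormedModType R}.
Variables (f : R -> X) (alpha beta K theta : R).
Implicit Types s t h : R.
Hypotheses (K0 : 0 <= K :> R) (theta0 : 0 < theta).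

Lemma small_powR (e : R) : 0 < e ->
  exists2 r : R, 0 < r & forall h, 0 <= h -> h <= r -> K * h `^ theta < e.
Proof.
move=> e0; have K1 : 0 < K + 1 by rewrite ltr_wpDl.
have e1 : 0 < e / (K + 1) by exact: divr_gt0.
exists ((e / (K + 1)) `^ theta^-1); first exact: powR_gt0.
move=> h h0 hr.
have : h `^ theta <= e / (K + 1).
  have -> : e / (K + 1) = ((e / (K + 1)) `^ theta^-1) `^ theta.
    by rewrite -powRrM mulVf ?gt_eqF// powRr1// ltW.
  by apply: ge0_ler_powR; rewrite ?nnegrE ?powR_ge0// ltW.
rewrite ler_pdivlMr// mulrDr mulr1 mulrC => H.
have := powR_ge0 h theta; rewrite le_eqVlt => /predU1P[<-|]; first by rewrite mulr0.
lra.
Qed.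

Hypothesis compare : forall s h h', alpha < s < beta -> alpha < s + h < beta ->
  alpha < s - h < beta -> h != 0 -> h' != 0 -> `|h'| <= `|h| ->
  `|slope f s (s + h') - slope f s (s + h)| <= K * `|h| `^ theta.

Lemma slope_radius s (e : R) : alpha < s < beta -> 0 < e ->
  exists2 r : R, 0 < r & forall h, h != 0 -> `|h| <= r ->
    [/\ alpha < s + h < beta, alpha < s - h < beta & K * `|h| `^ theta < e].
Proof.
move=> /andP[s1 s2] e0; have [r r0 rP] := small_powR e0.
exists (Num.min r (Num.min ((s - alpha) / 2) ((beta - s) / 2))).
  by rewrite !lt_min r0 /=; apply/andP; split; lra.
move=> h h0; rewrite !le_min => /and3P[hr h1 h2]; split; last exact: rP.
- by move: h1 h2 => /[!ler_norml] /andP[? ?] /andP[? ?]; apply/andP; split; lra.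
- by move: h1 h2 => /[!ler_norml] /andP[? ?] /andP[? ?]; apply/andP; split; lra.
Qed.

Lemma slope_difference_quotient s h :
  h^-1 *: (f (h *: 1 + s) - f s) = slope f s (s + h).
Proof. by rewrite /slope scaler1 (addrC h) [s + h - s]addrC addKr. Qed.

Lemma slope_derivable s : alpha < s < beta -> derivable f s 1.
Proof.
move=> ws; apply/cauchy_cvgP; apply/cauchy_exP => e e0.
have [r r0 rP] := slope_radius ws e0.
have rr : r != 0 by rewrite gt_eqF.
have [w1 w2 re] : [/\ alpha < s + r < beta, alpha < s - r < beta & K * `|r| `^ theta < e].
  by apply: rP; rewrite // ger0_norm// ltW.
exists (slope f s (s + r)).
apply/nbhs_ballP; exists r => // h; rewrite -ball_normE/= sub0r normrN => hr h0.
rewrite -ball_normE/= slope_difference_quotient distrC.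
apply: le_lt_trans re; apply: compare => //.
by rewrite [leRHS]ger0_norm ltW.
Qed.

Lemma slope_derive1 s h : alpha < s < beta -> alpha < s + h < beta ->
  alpha < s - h < beta -> h != 0 ->
  `|derive1 f s - slope f s (s + h)| <= K * `|h| `^ theta.
Proof.
move=> ws wh wnh h0; have := slope_derivable ws; rewrite /derivable => cv.
apply/ler_addgt0Pl => e e0.
have [r r0 rP] : exists2 r, 0 < r & forall h', h' != 0 -> `|h'| < r ->
    `|derive1 f s - slope f s (s + h')| < e.
  have /cvgrPdist_lt/(_ _ e0)/nbhs_ballP[r /= r0 rP] := cv.
  exists r => // h' h'0 h'r; have := rP h'.
  rewrite -ball_normE/= sub0r normrN slope_difference_quotient derive1E.
  exact.
(* A step small enough for both estimates. *)
pose h' := Num.min (r / 2) `|h|.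
have nh0 : 0 < `|h| by rewrite normr_gt0.
have h'0 : 0 < h' by rewrite lt_min nh0 andbT; lra.
have h'h : h' <= `|h| by rewrite ge_min lexx orbT.
have h'r : h' <= r / 2 by rewrite ge_min lexx.
rewrite -(subrKA (slope f s (s + h'))) (le_trans (ler_normD _ _))// lerD//.
  by apply: ltW; apply: rP; rewrite ?gt_eqF// ger0_norm ?ltW//; lra.
apply: compare => //; first by rewrite gt_eqF.
by rewrite (ger0_norm (ltW h'0)).
Qed.

Lemma slope_derive1_continuous s : alpha < s < beta ->
  {for s, continuous (derive1 f)}.
Proof.
move=> ws; apply/cvgrPdist_lt => e e0.
have e2 : 0 < e / 2 by lra.
have [r r0 rP] := slope_radius ws e2.
have r20 : 0 < r / 2 by lra.
apply/nbhs_ballP; exists (r / 2) => // t /= tr.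
have [->|ts] := eqVneq t s; first by rewrite subrr normr0.
pose h := t - s.
have h0 : h != 0 by rewrite subr_eq0.
have hr : `|h| <= r / 2 by rewrite /h distrC ltW.
have [w1 w2 he] := rP _ h0 ltac:(lra).
have [w3 w4 _] : [/\ alpha < s + 2 * h < beta, alpha < s - 2 * h < beta &
    K * `|2 * h| `^ theta < e / 2].
  apply: rP; first by rewrite mulf_neq0.
  by rewrite normrM [`|2|]ger0_norm//; lra.
have E : s + h = t by rewrite /h addrC subrK.
have H1 := slope_derive1 ws w1 w2 h0; rewrite E in H1.
have wt : alpha < t < beta by rewrite -E.
have H2 : `|derive1 f t - slope f t (t - h)| <= K * `|- h| `^ theta.
  apply: slope_derive1 => //; rewrite ?oppr_eq0//.
    by have -> : t - h = s by rewrite -E addrK.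
  by have -> : t - - h = s + 2 * h by rewrite -E; ring.
have E2 : t - h = s by rewrite -E addrK.
rewrite E2 slopeC normrN in H2.
rewrite -(subrKA (slope f s t)); apply: le_lt_trans (ler_normD _ _) _.
by rewrite (distrC _ (derive1 f t)); lra.
Qed.

End HolderSlopes.

(** * Slopes of an arc that is almost as short as its chords *)

Section ChordArc.
Context {R : realType} {X : normedModType R}.
Implicit Types (f : R -> X) (s m t h : R).

(** If chords are shorter than arcs only by a quadratic term, then slopes over
    adjacent intervals of comparable length are Hoelder close. *)
Lemma balanced_slopes f (alpha beta C : R) : power_type_convexity X ->
  0 <= C ->
  (forall s t, alpha < s -> s < t -> t < beta ->
     `|f t - f s| <= t - s /\ (t - s) - C * (t - s) ^+ 2 <= `|f t - f s|) ->
  exists K theta : R, [/\ 0 <= K, 0 < theta &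
    forall s m t, alpha < s -> s < m -> m < t -> t < beta ->
      t - s <= 4 * (m - s) -> t - s <= 4 * (t - m) ->
      `|slope f s m - slope f m t| <= K * (t - s) `^ theta].
Proof.
move=> hp C0 chord; have [K [theta [K0 th0 KP]]] := power_type_unit_ball hp.
exists (K * (2 * C) `^ theta), theta; split => //.
  by rewrite mulr_ge0 ?powR_ge0// ltW.
move=> s m t as_ sm mt tb sb1 sb2.
have unit u v : alpha < u -> u < v -> v < beta -> `|slope f u v| <= 1.
  move=> au uv vb; have [le1 _] := chord u v au uv vb.
  rewrite /slope normrZ normfV gtr0_norm ?subr_gt0//.
  by rewrite mulrC ler_pdivrMr ?subr_gt0// mul1r.
have x1 := unit s m as_ sm (lt_trans mt tb).
have y1 := unit m t (lt_trans as_ sm) mt tb.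
have st := lt_trans sm mt.
have [_ ch] := chord s t as_ st tb.
have E : f t - f s = (m - s) *: slope f s m + (t - m) *: slope f m t.
  rewrite /slope !scalerA !mulfV ?subr_eq0 ?gt_eqF// !scale1r.
  by rewrite [RHS]addrC subrKA.
rewrite E in ch.
set x := slope f s m in x1 ch *; set y := slope f m t in y1 ch *.
have h0 : 0 < t - s by rewrite subr_gt0.
have D0 : 0 <= 2 - `|x + y|.
  by rewrite subr_ge0 (le_trans (ler_normD _ _))//; lra.
have key : exists2 l : R, 0 < l /\ t - s <= 4 * l & l * (2 - `|x + y|) <= C * (t - s) ^+ 2.
  have [le1|/ltW le1] := leP (m - s) (t - m).
    exists (m - s); first by split => //; rewrite subr_gt0.
    by apply: (norm_sum_unbalanced _ le1) => //; lra.
  exists (t - m); first by split => //; rewrite subr_gt0.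
  rewrite (addrC x); apply: (norm_sum_unbalanced _ le1) => //; first by lra.
  by rewrite [X in _ <= `|X|]addrC; lra.
have {key} hxy : 2 * (1 - 2 * C * (t - s)) <= `|x + y|.
  case: key => l [l0 l4] lh.
  have Ch0 : 0 <= C * (t - s) by rewrite mulr_ge0// ltW.
  have : l * (2 - `|x + y|) <= l * (4 * (C * (t - s))).
    apply: le_trans lh _.
    have -> : l * (4 * (C * (t - s))) = C * (t - s) * (4 * l) by ring.
    by rewrite expr2 mulrA ler_wpM2l.
  by rewrite ler_pM2l//; lra.
rewrite -mulrA -powRM; [|lra|lra].
by apply: KP => //; rewrite !mulr_ge0// ltW.
Qed.

End ChordArc.

(** * Extension of an arc to the whole line *)

Section Clamp.
Context {R : realType} {X : normedModType R}.
Variable Omega : set X.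
Implicit Types (f g : R -> X) (a b u v : R).

(** The nearest point of [a, b], if a <= b.  Composing with it extends a curve
    from [a, b] to the whole line by constants. *)
Definition clamp a b u : R := Num.max a (Num.min u b).

Lemma clamp_itv a b u : a <= b -> clamp a b u \in `[a, b].
Proof.
move=> ab; rewrite in_itv/= /clamp; case: (leP u b) => [ub|/ltW bu].
  by case: (leP a u) => [au|/ltW ua]; rewrite ?au ?ub ?lexx.
by rewrite max_r// ab lexx.
Qed.

Lemma clamp_id a b u : u \in `[a, b] -> clamp a b u = u.
Proof. by rewrite in_itv/= /clamp => /andP[au ub]; rewrite (min_l ub) max_r. Qed.

Lemma clamp_dist a b u v : a <= b -> `|clamp a b u - clamp a b v| <= `|u - v|.
Proof.
move=> ab.
suff H x y : x <= y -> `|clamp a b x - clamp a b y| <= `|x - y|.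
  by have [/H//|/ltW/H] := leP u v; rewrite distrC (distrC v).
move=> xy; rewrite distrC (distrC x) (ger0_norm (_ : 0 <= y - x)) ?subr_ge0// ler_norml.
rewrite /clamp; case: (leP x b) => xb; case: (leP y b) => yb;
  repeat match goal with |- context [Num.max ?p ?q] => case: (leP p q) => ? end;
  apply/andP; split; lra.
Qed.

Lemma unit_arc_clamp g a b : rectifiable_arc Omega g a b ->
  param_by_arc_length g a b -> unit_arc Omega (g \o clamp a b) a b.
Proof.
move=> [ab _ gi gO _] pg.
have E : {in `[a, b], g \o clamp a b =1 g}.
  by move=> u ub; rewrite /= clamp_id.
split => //.
- move=> u v /=; apply: le_trans (clamp_dist u v ab).
  have := clamp_itv u ab; have := clamp_itv v ab.
  move: (clamp a b u) (clamp a b v) => {}u {}v.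
  suff H x y : x \in `[a, b] -> y \in `[a, b] -> x <= y -> `|g x - g y| <= `|x - y|.
    move=> va ua; have [/H->//|/ltW/H] := leP u v.
    by rewrite distrC (distrC v); apply.
  move=> /[!in_itv]/= /andP[ax xb] /andP[ay yb] xy.
  rewrite distrC (distrC x) ger0_norm ?subr_ge0//.
  exact: param_by_arc_length_dist pg.
- move=> s t as_ st tb; rewrite -pg//; apply: eq_curve_length => u /[!in_itv]/= /andP[su ut].
  by apply: E; rewrite in_itv/= (le_trans as_ su) (le_trans ut tb).
- by move=> u v ua va; rewrite !E//; exact: gi.
- by move=> u ua; apply: gO; exists u => //; rewrite E.
Qed.

Lemma eq_qh_length f g a b : a <= b -> {in `[a, b], f =1 g} ->
  param_by_arc_length f a b -> param_by_arc_length g a b ->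
  qh_length Omega f a b = qh_length Omega g a b.
Proof.
move=> ab fg pf pg; rewrite /qh_length /arc_integral pf// pg//=.
apply: eq_integral => s /set_mem/=; rewrite in_itv/= => /andP[s0 sb].
rewrite (arc_length_reparam_unit pf) ?s0// (arc_length_reparam_unit pg) ?s0// fg//.
by rewrite in_itv/=; apply/andP; split; lra.
Qed.

End Clamp.

(** * Smoothness of quasihyperbolic geodesics *)

Section Geodesic.
Context {R : realType} {X : normedModType R}.
Variable Omega : set X.
Hypotheses (oO : open Omega) (bO : boundary Omega !=set0).

Lemma qh_geodesic_minimizing g a b : qh_geodesic Omega g a b ->
  param_by_arc_length g a b -> qh_minimizing Omega (g \o clamp a b) a b.
Proof.
move=> [ra qa] pg f b' fa fga fgb.
have ab : a <= b by case: ra.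
have uc := unit_arc_clamp ra pg.
have aI : a \in `[a, b] by rewrite in_itv/= lexx ab.
have bI : b \in `[a, b] by rewrite in_itv/= lexx ab.
rewrite -lee_fin -!qh_length_unit_arc//.
rewrite (@eq_qh_length _ _ Omega _ g)//; last by case: uc.
  rewrite qa; apply: ereal_inf_lbound; exists f, a, b'; split => //.
  - exact: unit_arc_rectifiable.
  - by rewrite fga/= clamp_id.
  - by rewrite fgb/= clamp_id.
by move=> u ua /=; rewrite clamp_id.
Qed.

(** The chord estimate with constants that are uniform near t0.  If the ball of
    radius r0 about g t0 lies in Omega and 5 r <= r0, then at parameters within r
    of t0 the distance of g from the boundary is at least r0 / 2. *)
Lemma qh_geodesic_chord g a b t0 : qh_geodesic Omega g a b ->
  param_by_arc_length g a b -> a < t0 -> t0 < b ->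
  exists r C : R, [/\ 0 < r, 0 <= C &
    forall s t, t0 - r < s -> s < t -> t < t0 + r ->
     `|g t - g s| <= t - s /\ (t - s) - C * (t - s) ^+ 2 <= `|g t - g s|].
Proof.
move=> geo pg at0 t0b.
have uc : unit_arc Omega (g \o clamp a b) a b by apply: unit_arc_clamp => //; case: geo.
have qmin := qh_geodesic_minimizing geo pg.
have E u : a <= u -> u <= b -> (g \o clamp a b) u = g u.
  by move=> au ub; rewrite /= clamp_id// in_itv/= au.
move: (g \o clamp a b) uc qmin E => f uf fmin E; have [ab fn _ _ fO] := uf.
have /nbhs_ballP[r0 /= r00 r0O] : nbhs (f t0) Omega.
  by apply: open_nbhs_nbhs; split => //; apply: fO; rewrite in_itv/= !ltW.
have [r [rp ra rb rr]] : exists r, [/\ 0 < r, r <= t0 - a, r <= b - t0 & 5 * r <= r0].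
  exists (Num.min (r0 / 5) (Num.min (t0 - a) (b - t0))).
  have m1 : Num.min (r0 / 5) (Num.min (t0 - a) (b - t0)) <= r0 / 5.
    by rewrite ge_min lexx.
  split.
  - by rewrite !lt_min; apply/and3P; split; lra.
  - by rewrite !ge_min lexx !orbT.
  - by rewrite !ge_min lexx !orbT.
  - by move: m1; lra.
exists r, (4 / r0); split => //; first by rewrite divr_ge0// ltW.
move=> s t sr st tr.
have as_ : a <= s by lra.
have tb : t <= b by lra.
rewrite -!E//; [|lra|lra].
split.
  by apply: le_trans (fn t s) _; rewrite gtr0_norm ?subr_gt0.
have fs : `|f t0 - f s| < r.
  apply: le_lt_trans (fn t0 s) _; rewrite ltr_norml; apply/andP; split; lra.
have sub e : e <= 4 * r -> ball (f s) e `<=` Omega.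
  move=> er y; rewrite -ball_normE/= => ye; apply: r0O; rewrite -ball_normE/=.
  by rewrite -(subrKA (f s)) (le_lt_trans (ler_normD _ _))//; lra.
have d0 : r0 / 2 <= norm_dist (boundary Omega) (f s).
  apply: ball_norm_dist_boundary => // y; rewrite -ball_normE/= => ye.
  apply: r0O; rewrite -ball_normE/=.
  rewrite -(subrKA (f s)) (le_lt_trans (ler_normD _ _))//; lra.
apply: le_trans (qh_minimizing_chord_ge oO bO uf fmin as_ st tb _); last first.
  by apply: sub; lra.
rewrite lerD2l lerN2 ler_wpM2r ?exprn_ge0 ?subr_ge0 ?(ltW st)//.
have dp : 0 < norm_dist (boundary Omega) (f s) by lra.
rewrite ler_pdivrMr// mulrAC ler_pdivlMr//; lra.
Qed.

End Geodesic.

Theorem corollary3p2 (R : realType) (X : completeNormedModType R)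
    (hdim : dim_ge2 X)
    (huc : uniformly_convex X)
    (hpt : power_type_convexity X)
    (Omega : set X)
    (hproper : Omega <> setT)
    (hopen : open Omega)
    (hconn : path_connected Omega)
    (gamma : R -> X) (a b : R)
    (hgeod : qh_geodesic Omega gamma a b)
    (hparam : param_by_arc_length gamma a b) :
  C1_smooth gamma a b.
Proof.
move=> t0 at0 t0b.
have bO : boundary Omega !=set0.
  apply: boundary_neq0 => //; exists (gamma t0).
  have [[_ _ _ gO _] _] := hgeod.
  by apply: gO; exists t0 => //=; rewrite in_itv/= !ltW.
have [r [C [r0 C0 chord]]] := qh_geodesic_chord hopen bO hgeod hparam at0 t0b.
have [K [theta [K0 th0 bal]]] := balanced_slopes hpt C0 chord.
have [K2 K20 cmp] := slope_compare K0 th0 bal.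
have wt0 : t0 - r < t0 < t0 + r by apply/andP; split; lra.
split; first exact: (slope_derivable K20 th0 cmp wt0).
exact: (slope_derive1_continuous K20 th0 cmp wt0).
Qed.
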